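(* Let $k\ge1$ be an integer. Let $L:\mathbb{T}^{d+1}\times\mathbb{R}^d\to\mathbb{R}$ be a $C^2$ function, strictly convex in $v$ and superlinear in $v$, i.e. $L(z,v)/|v|\to+\infty$ as $|v|\to+\infty$, and let $H:\mathbb{T}^{d+1}\times\mathbb{R}^d\to\mathbb{R}$ be the Legendre transform of $L$. Then $$\inf_{\mu\in\mathcal{C}}A_{L,k}(\mu)\ \ge\ -\frac1k\inf_{\varphi\in C^1(\mathbb{T}^{d+1})}\log I_k[\varphi].$$
   Context: $\mathbb{T}=\mathbb{R}/\mathbb{Z}$; points of $\mathbb{T}^{d+1}$ are written $z=(x,t)$ with $x\in\mathbb{T}^d$, $t\in\mathbb{T}$; $\nabla$ is the gradient in $x$. The Legendre transform is $H(z,p)=\sup_{v\in\mathbb{R}^d}(p\cdot v-L(z,v))$. For $\varphi\in C^1(\mathbb{T}^{d+1})$, $$I_k[\varphi]=\int_{\mathbb{T}^{d+1}}e^{k(\varphi_t+H(x,t,\nabla\varphi))}\,dx\,dt.$$ For a Borel probability measure $\mu$ on $\mathbb{T}^{d+1}\times\mathbb{R}^d$ let $m_\mu$ be its push-forward to $\mathbb{T}^{d+1}$ under $(z,v)\mapsto z$. For a Borel probability measure $m$ on $\mathbb{T}^{d+1}$ that is absolutely continuous with respect to Lebesgue measure (density also denoted $m$) put $S^*[m]=\int_{\mathbb{T}^{d+1}}m(z)\log m(z)\,dz\in(-\infty,+\infty]$. For an arbitrary Borel probability measure $m$ on $\mathbb{T}^{d+1}$ let $\bar S[m]$ be the infimum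 of $\liminf_n S^*[m_n]$ over all sequences of absolutely continuous probability measures $m_n$ converging weakly to $m$ (the lower semicontinuous convex extension of $S^*$; the value $+\infty$ is allowed). Put $S[\mu]=\bar S[m_\mu]$. Let $\mathcal{C}$ be the set of Borel probability measures $\mu$ on $\mathbb{T}^{d+1}\times\mathbb{R}^d$ such that (a) $\int|v|\,d\mu(z,v)<+\infty$ and (b) $\int(\varphi_t+\nabla\varphi\cdot v)\,d\mu(x,t,v)=0$ for all $\varphi\in C^1(\mathbb{T}^{d+1})$. For $\mu\in\mathcal{C}$ put $A_{L,k}(\mu)=\int_{\mathbb{T}^{d+1}\times\mathbb{R}^d}L(z,v)\,d\mu+\frac1kS[\mu]\in(-\infty,+\infty]$. *)

(* Defs.v *)
From HB Require Import structures.
From mathcomp Require Import all_boot all_order all_algebra.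
From mathcomp Require Import generic_quotient.
From mathcomp Require Import all_classical all_reals all_analysis.
From mathcomp Require Import measurable_realfun.

Set Implicit Arguments.
Unset Strict Implicit.
Unset Printing Implicit Defensive.

Import Order.TTheory GRing.Theory Num.Theory.
Import numFieldNormedType.Exports.

Local Open Scope classical_set_scope.
Local Open Scope ring_scope.
Local Open Scope quotient_scope.
Local Open Scope charge_scope.

Section torus.
Context (R : realType) (n : nat).

Definition lattice_rel : rel 'rV[R]_n :=
  fun x y => [forall i, x 0 i - y 0 i \is a Num.int].

Lemma lattice_rel_refl : reflexive lattice_rel.
Proof. by move=> x; apply/forallP => i; rewrite subrr int_num0. Qed.

Lemma lattice_rel_sym : symmetric lattice_rel.
Proof.
by move=> x y; apply/forallP/forallP => h i; rewrite -opprB rpredN.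
Qed.

Lemma lattice_rel_trans : transitive lattice_rel.
Proof.
move=> y x z /forallP h1 /forallP h2; apply/forallP => i.
by rewrite -(subrK (y 0 i) (x 0 i)) -addrA rpredD.
Qed.

Canonical lattice_equiv :=
  EquivRel lattice_rel lattice_rel_refl lattice_rel_sym lattice_rel_trans.

(* R^n / Z^n with the quotient topology. *)
Definition torus : Type := quotient_topology {eq_quot lattice_equiv}.

HB.instance Definition _ := Topological.on torus.
HB.instance Definition _ := Pointed.on torus.
HB.instance Definition _ := Quotient.on torus.

Definition torus_proj (y : 'rV[R]_n) : torus := \pi_torus y.

End torus.

(* A topological space equipped with its Borel sigma-algebra. *)
Notation borel T := (g_sigma_algebraType (@open T)).

Section unit_cube.
Context (R : realType).
Local Notation mR := (measurableTypeR R).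

Definition tuple_cons n (x : mR * n.-tuple mR) : n.+1.-tuple mR :=
  [tuple of x.1 :: x.2].

Lemma measurable_tuple_cons n : measurable_fun setT (@tuple_cons n).
Proof. exact: measurable_cons. Qed.

HB.instance Definition _ n :=
  isMeasurableFun.Build _ _ _ _ (@tuple_cons n) (@measurable_tuple_cons n).

(* Lebesgue measure on [0, 1]^n. *)
Fixpoint unit_cube n : probability (n.-tuple mR) R :=
  match n with
  | 0 => dirac [tuple]
  | m.+1 => distribution (uniform_prob (@ltr01 R) \x unit_cube m)%E
              (@tuple_cons m)
  end.

End unit_cube.

Section torus_measure.
Context (R : realType) (n : nat).

Definition torus_of_tuple (t : n.-tuple (measurableTypeR R)) : borel (torus R n) :=
  torus_proj (\row_i tnth t i).

Lemma measurable_ball_tuple (q : 'rV[R]_n) (e : R) :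
  measurable [set t : n.-tuple (measurableTypeR R) | ball q e (\row_i tnth t i)].
Proof.
have [e0|e0] := ltP 0 e; last first.
  rewrite (_ : [set _ | _] = set0)//; apply/seteqP; split => // t /= [e0' _].
  by move: e0; rewrite leNgt e0'.
rewrite (_ : [set _ | _] =
    \bigcap_(i : 'I_n) (fun t : n.-tuple (measurableTypeR R) => tnth t i) @^-1` ball (q 0 i) e); last first.
  apply/seteqP; split => t /=.
    by move=> [_ h] i _ /=; have := h 0 i; rewrite mxE.
  by move=> h; split => // i j; rewrite mxE ord1; exact: h.
apply: fin_bigcap_measurable => // i _.
rewrite -[X in measurable X]setTI; apply: measurable_tnth => //.
by apply: measurable_ball.
Qed.

(* The open subsets of R^n are countable unions of balls with rational centres
   and radii 1 / (j + 1). *)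
Lemma measurable_torus_of_tuple : measurable_fun setT torus_of_tuple.
Proof.
have := @measurability _ _ _ _ setT torus_of_tuple (@open (torus R n)) erefl; apply.
move=> _ [U oU <-]; rewrite setTI.
have oV : open (@torus_proj R n @^-1` U) by [].
pose c (p : 'rV[rat]_n * nat) : 'rV[R]_n := map_mx ratr p.1.
pose B (p : 'rV[rat]_n * nat) : set 'rV[R]_n := ball (c p) p.2.+1%:R^-1.
rewrite (_ : torus_of_tuple @^-1` U =
  \bigcup_(p in [set p | B p `<=` @torus_proj R n @^-1` U])
    [set t | B p (\row_i tnth t i)]); last first.
  apply/seteqP; split => [t /= Ut|t [p /= BU Bt]]; last exact: BU.
  have /nbhs_ballP[e /= e0 eU] :
      nbhs (\row_i tnth t i) (@torus_proj R n @^-1` U).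
    exact: open_nbhs_nbhs.
  have [j /= je] : exists j, j.+1%:R^-1 < e / 2.
    have e20 : 0 < e / 2 by rewrite divr_gt0.
    have [N _ /(_ N (leqnn _))/= h] := near_infty_natSinv_lt (PosNum e20).
    by exists N; exact: h.
  have j0 : 0 < j.+1%:R^-1 :> R by rewrite invr_gt0.
  have /choice[q qP] (i : 'I_n) : exists q : rat, `|ratr q - tnth t i| < j.+1%:R^-1.
    have [|q] := @rat_in_itvoo R (tnth t i - j.+1%:R^-1) (tnth t i + j.+1%:R^-1).
      by rewrite ltrBlDr -addrA ltrDl addr_gt0.
    rewrite in_itv/= => /andP[q1 q2]; exists q.
    by rewrite ltr_distl q1 q2.
  have Bt : B (\row_i q i, j) (\row_i tnth t i).
    split => // i k; rewrite !mxE/=; exact: qP.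
  exists (\row_i q i, j) => // y By; apply: eU.
  have := ball_triangle (ball_sym Bt) By.
  apply: le_ball; rewrite [leRHS]splitr lerD// ltW//.
rewrite bigcup_mkcond; apply: countable_bigcupT_measurable.
  exact: countableP.
by move=> p; case: ifP => // _; exact: measurable_ball_tuple.
Qed.

HB.instance Definition _ :=
  isMeasurableFun.Build _ _ _ _ torus_of_tuple measurable_torus_of_tuple.

Definition torus_lebesgue : probability (borel (torus R n)) R :=
  distribution (unit_cube R n) torus_of_tuple.
End torus_measure.

Section calculus.
Context (R : realType).

(* Class C^k through iterated directional derivatives; on a finite-dimensional
   space this is the usual notion. *)
Fixpoint Ck (k : nat) (V : normedModType R) (f : V -> R) : Prop :=
  match k with
  | 0 => continuous f
  | j.+1 => continuous f /\
      forall v, (forall x, derivable f x v) /\ Ck j (fun x => 'D_v f x)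
  end.

Definition dot n (p v : 'rV[R]_n) : R := \sum_i p 0 i * v 0 i.

(* The Euclidean norm; the library's norm on matrices is the sup norm. *)
Definition enorm n (v : 'rV[R]_n) : R := Num.sqrt (dot v v).

Definition torus_C1 n (phi : torus R n -> R) : Prop :=
  Ck 1 (phi \o @torus_proj R n).

(* By periodicity of the lift, the choice of representative is irrelevant. *)
Definition torus_partial n (phi : torus R n -> R) (i : 'I_n) (z : torus R n) : R :=
  'D_(delta_mx 0 i) (phi \o @torus_proj R n) (repr z).

End calculus.

(* Points of T^(d+1) are z = (x, t): the first d coordinates are x and the last
   one is t. *)
Section lagrangian.
Context (R : realType) (d : nat).

Notation space_time := (torus R d.+1).
Notation velocity := 'rV[R]_d.
Notation phase := (space_time * velocity)%type.

Definition time_derivative (phi : space_time -> R) (z : space_time) : R :=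
  torus_partial phi ord_max z.

Definition gradient (phi : space_time -> R) (z : space_time) : velocity :=
  \row_i torus_partial phi (lift ord_max i) z.

Implicit Type L : phase -> R.

Definition lagrangian_C2 L : Prop :=
  Ck 2 (fun w : 'rV[R]_d.+1 * velocity => L (torus_proj w.1, w.2)).

Definition strictly_convex_velocity L : Prop :=
  forall (z : space_time) (v w : velocity) (s : R), v != w -> 0 < s < 1 ->
    L (z, s *: v + (1 - s) *: w) < s * L (z, v) + (1 - s) * L (z, w).

Definition superlinear_velocity L : Prop :=
  forall (z : space_time) (A : R), exists M : R, forall v : velocity,
    M < enorm v -> A <= L (z, v) / enorm v.

(* The supremum is finite when L is continuous and superlinear. *)
Definition legendre L (w : phase) : R :=
  sup (range (fun v : velocity => dot w.2 v - L (w.1, v))).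

Definition exp_integral (k : nat) (H : phase -> R) (phi : space_time -> R) : \bar R :=
  (\int[torus_lebesgue R d.+1]_z
    (expR (k%:R * (time_derivative phi z + H (z, gradient phi z))))%:E)%E.

Definition base_proj : borel phase -> borel space_time := fst.

Lemma measurable_base_proj : measurable_fun setT base_proj.
Proof.
have := @measurability _ _ _ _ setT base_proj (@open space_time) erefl; apply.
move=> _ [U oU <-]; rewrite setTI; apply: sub_sigma_algebra.
by apply: open_comp => // w _; exact: cvg_fst.
Qed.

HB.instance Definition _ :=
  isMeasurableFun.Build _ _ _ _ base_proj measurable_base_proj.

Definition base_marginal (mu : probability (borel phase) R) :
  probability (borel space_time) R := distribution mu base_proj.

(* Every continuous function on the torus is bounded. *)
Definition weak_cvg (m_ : nat -> probability (borel space_time) R)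
    (m : probability (borel space_time) R) : Prop :=
  forall g : space_time -> R, continuous g ->
    (\int[m_ n]_z (g z)%:E @[n --> \oo] --> \int[m]_z (g z)%:E)%E.

Definition abs_continuous (m : probability (borel space_time) R) : Prop :=
  m `<< torus_lebesgue R d.+1.

(* Meaningful only when m is absolutely continuous; 0 * ln 0 = 0. *)
Definition entropy (m : probability (borel space_time) R) : \bar R :=
  (\int[torus_lebesgue R d.+1]_z
    let r := fine (('d (charge_of_finite_measure m) '/d (torus_lebesgue R d.+1)) z)
    in (r * ln r)%:E)%E.

Definition relaxed_entropy (m : probability (borel space_time) R) : \bar R :=
  ereal_inf [set s | exists m_ : nat -> probability (borel space_time) R,
    [/\ forall n, abs_continuous (m_ n), weak_cvg m_ m &
        s = limn_einf (fun n => entropy (m_ n))]].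

Definition closed_measure : set (probability (borel phase) R) :=
  [set mu : probability (borel phase) R | (\int[mu]_w (enorm w.2)%:E < +oo)%E /\
    forall phi : space_time -> R, torus_C1 phi ->
      (\int[mu]_w (time_derivative phi w.1 +
                   dot (gradient phi w.1) w.2)%:E = 0)%E].

Definition action (k : nat) L (mu : probability (borel phase) R) : \bar R :=
  (\int[mu]_w (L w)%:E + (k%:R^-1)%:E * relaxed_entropy (base_marginal mu))%E.

End lagrangian.

(* Main.v *)
Require Import Defs.
From mathcomp Require Import all_boot all_order all_algebra.
From mathcomp Require Import generic_quotient.
From mathcomp Require Import all_classical all_reals all_analysis.
From mathcomp Require Import measurable_realfun ring lra.
Import Order.TTheory GRing.Theory Num.Theory.
Import numFieldNormedType.Exports.
Set Implicit Arguments.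
Unset Strict Implicit.
Unset Printing Implicit Defensive.
Local Open Scope classical_set_scope.
Local Open Scope ring_scope.

(** This is the easy half of a convex duality: every test function phi gives a
    lower bound for every closed measure mu. Put
    [g z = phi_t z + H (z, grad phi z)].

    The Fenchel inequality [p . v - L <= H] at [p = grad phi z] reads
    [L (z, v) >= (phi_t + grad phi . v) - g z]. The bracket integrates to 0
    against a closed measure, so [int L dmu >= - int g dm] where m is the base
    marginal of mu (lemma [lagrangian_integral_ge]).

    The entropy is bounded below by the Gibbs variational inequality
    [int k g dn - ln (int exp (k g)) <= entropy n] for absolutely continuous n
    (lemma [gibbs_variational]), which is the integral of Young's inequality
    [r (a + 1) - exp a <= r ln r] with r the density of n and
    [a = k g - ln (int exp (k g))]. The left-hand side is weakly continuous in n
    because g is continuous, so the inequality passes to the relaxed entropy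
    (lemma [relaxed_entropy_ge]). Adding the first bound to 1/k times the second
    eliminates [int g dm] and leaves
    [action mu >= - 1/k ln (int exp (k g))].

    What needs work is the continuity of g, that is, of the Hamiltonian along
    a continuous field of momenta. Superlinearity is only assumed pointwise in
    z, so the supremum defining H has to be localized uniformly: concavity of
    [v |-> p . v - L (z, v)] reduces this to a strict inequality on a sphere,
    which is compact, and the tube lemma propagates it to nearby z (lemma
    [concave_sup_continuous]). Compactness of the torus then bounds all the
    continuous functions involved, which settles integrability. *)

(** * The torus as a quotient space *)

Section torus_topology.
Context {R : realType} {n : nat}.
Implicit Types x y : 'rV[R]_n.

Lemma torus_proj_eqP x y :
  reflect (forall i, x 0 i - y 0 i \is a Num.int)
          (torus_proj x == torus_proj y).
Proof.
have eqv := @eqquotP _ (lattice_equiv R n) {eq_quot lattice_equiv R n}%qT x y.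
by apply: (iffP eqP) => [/eqv/forallP|/forallP/eqv].
Qed.

Lemma torus_proj_add_int x y :
  (forall i, y 0 i \is a Num.int) -> torus_proj (x + y) = torus_proj x.
Proof.
move=> y_int; apply/eqP/torus_proj_eqP => i.
by rewrite mxE addrAC subrr add0r.
Qed.

Lemma torus_projK (z : torus R n) : torus_proj (repr z) = z.
Proof. exact: reprK. Qed.

Lemma torus_proj_continuous : continuous (@torus_proj R n).
Proof. exact: pi_continuous. Qed.

Lemma torus_continuous (Z : topologicalType) (f : torus R n -> Z) :
  continuous (f \o @torus_proj R n) -> continuous f.
Proof. by move=> ?; apply/quotient_continuous. Qed.

Lemma torus_proj_open (U : set 'rV[R]_n) :
  open U -> open (@torus_proj R n @` U).
Proof.
move=> oU; suff : open (@torus_proj R n @^-1` (@torus_proj R n @` U)) by [].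
(* The saturation of U is the union of its integer translates. *)
rewrite (_ : _ @^-1` _ =
    \bigcup_(y in [set y : 'rV[R]_n | forall i, y 0 i \is a Num.int])
    ((fun x : 'rV[R]_n => x + y) @^-1` U)); last first.
  apply/seteqP; split => x /=.
    move=> [u Uu /eqP/torus_proj_eqP ux]; exists (u - x) => /=.
      by move=> i; rewrite !mxE.
    by rewrite addrC subrK.
  by move=> [y y_int Uxy]; exists (x + y) => //; exact: torus_proj_add_int.
apply: bigcup_open => y _; apply: open_comp => // x _.
have -> : (fun z : 'rV[R]_n => z + y) = (id \+ cst y) by [].
by apply: (@continuousD _ _ _ id (cst y)) => //; exact: cst_continuous.
Qed.

Lemma torus_compact : compact [set: torus R n].
Proof.
rewrite (_ : setT = @torus_proj R n @`
    [set x : 'rV[R]_n | forall i, `[0, 1]%classic (x ord0 i)]).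
  apply: continuous_compact.
    exact/continuous_subspaceT/torus_proj_continuous.
  apply: (@rV_compact R n (fun=> `[(0 : R), 1]%classic)) => _.
  exact: segment_compact.
apply/seteqP; split => // z _.
exists (\row_i (repr z 0 i - (Num.floor (repr z 0 i))%:~R)) => /=.
  move=> i; rewrite mxE in_itv/= subr_ge0.
  have := floorD1_gt (repr z 0 i); have := floor_le (repr z 0 i).
  by rewrite intrD; lra.
rewrite -[RHS]torus_projK; apply/eqP/torus_proj_eqP => i.
by rewrite mxE addrAC subrr add0r rpredN intr_int.
Qed.

Lemma torus_bounded (g : torus R n -> R) : continuous g ->
  exists2 M, 0 <= M & forall z, `|g z| <= M.
Proof.
move=> gc; have /compact_bounded[M [_ gM]] : compact (g @` setT).
  apply: continuous_compact; first exact: continuous_subspaceT.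
  exact: torus_compact.
exists (`|M| + 1); first by rewrite addr_ge0.
move=> z; apply: (gM (`|M| + 1)); last by exists z.
by rewrite (le_lt_trans (ler_norm M))// ltrDl.
Qed.

(** Products of quotient maps need not be quotient maps; here the product is
    one because the projection to the torus is open. *)
Lemma torus_prod_continuous (V Z : topologicalType) (f : torus R n * V -> Z) :
  continuous (fun w : 'rV[R]_n * V => f (torus_proj w.1, w.2)) -> continuous f.
Proof.
move=> fc [z v] A /= fA.
have := fc (repr z, v) A; rewrite /nbhs/= torus_projK => /(_ fA).
move=> [[/= B C] [+ Cv] BC]; rewrite nbhsE => -[U [oU Uz] UB].
exists (@torus_proj R n @` U, C) => /=.
  split => //; apply: open_nbhs_nbhs; split; first exact: torus_proj_open.
  by exists (repr z) => //; exact: torus_projK.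
move=> [_ v'] /= [[x Ux <-] Cv'].
by apply: (BC (x, v')); split => //=; exact: UB.
Qed.

(** The representative chosen by [repr] differs from y by an integer vector,
    under which the lift of phi is invariant. *)
Lemma torus_partialE (phi : torus R n -> R) i y :
  torus_partial phi i (torus_proj y) =
  'D_(delta_mx 0 i) (phi \o @torus_proj R n) y.
Proof.
rewrite /torus_partial /derive; congr (lim _).
pose f := phi \o @torus_proj R n.
rewrite (_ : (fun h : R => _) =
  (fun h : R => h^-1 *: ((f \o shift y) (h *: delta_mx 0 i) - f y)))//.
apply/funext => h /=.
have /eqP/torus_proj_eqP ry := torus_projK (torus_proj y).
rewrite torus_projK; congr (h^-1 *: (phi _ - _)).
by apply/eqP/torus_proj_eqP => j; rewrite !mxE opprD addrACA subrr add0r.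
Qed.

Lemma torus_partial_continuous (phi : torus R n -> R) i :
  torus_C1 phi -> continuous (torus_partial phi i).
Proof.
move=> [_ /(_ (delta_mx 0 i))[_ dphi]]; apply: torus_continuous.
rewrite (_ : _ \o _ = 'D_(delta_mx 0 i) (phi \o @torus_proj R n))//.
by apply/funext => y; exact: torus_partialE.
Qed.

End torus_topology.

(** * Suprema of concave functions depending on a parameter *)

Lemma continuous_compose (X Y Z : topologicalType) (f : X -> Y) (g : Y -> Z) :
  continuous f -> continuous g -> continuous (fun x => g (f x)).
Proof. by move=> fc gc x; exact: (continuous_comp (fc x) (gc (f x))). Qed.

Lemma continuous_pair (X Y Z : topologicalType) (f : X -> Y) (g : X -> Z) :
  continuous f -> continuous g -> continuous (fun x => (f x, g x)).
Proof. by move=> fc gc x; exact: cvg_pair (fc x) (gc x). Qed.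

Section spheres.
Context {R : realType} {d : nat}.

Lemma norm_le_compact (N : R) : compact [set v : 'rV[R]_d | `|v| <= N].
Proof.
apply: bounded_closed_compact.
  exists N; split; first by rewrite num_real.
  by move=> M NM v /= /le_trans; apply; exact: ltW.
apply: (@preimage_closed _ _ (fun v : 'rV[R]_d => `|v|) [set r | r <= N]).
  by move=> v _; exact: norm_continuous.
exact: closed_le.
Qed.

Lemma norm_eq_compact (N : R) : compact [set v : 'rV[R]_d | `|v| = N].
Proof.
apply: (subclosed_compact _ (@norm_le_compact N)); last by move=> v /= ->.
apply: (@preimage_closed _ _ (fun v : 'rV[R]_d => `|v|) [set r | r = N]).
  by move=> v _; exact: norm_continuous.
exact: closed_eq.
Qed.

End spheres.

Section concave_sup.
Context {R : realType} {T : topologicalType} {d : nat}.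
Variable F : T * 'rV[R]_d -> R.
Hypothesis F_cont : continuous F.
Hypothesis F_concave : forall z v w s, 0 < s < 1 ->
  s * F (z, v) + (1 - s) * F (z, w) <= F (z, s *: v + (1 - s) *: w).
Hypothesis F_coercive : forall z, exists2 N, 0 < N &
  forall v, `|v| = N -> F (z, v) < F (z, 0).

(** A concave function that lies below its value at 0 on a sphere lies below it
    outside the ball: the point of the sphere on the segment from 0 to v would
    otherwise carry a value at least F (z, 0). *)
Lemma concave_lt_outside z N : 0 < N ->
  (forall v, `|v| = N -> F (z, v) < F (z, 0)) ->
  forall v, N <= `|v| -> F (z, v) < F (z, 0).
Proof.
move=> N0 FN v; rewrite le_eqVlt => /predU1P[/esym/FN//|Nv].
have v0 : 0 < `|v| := lt_trans N0 Nv.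
have s01 : 0 < N / `|v| < 1 by rewrite divr_gt0//= ltr_pdivrMr// mul1r.
have := F_concave z v 0 s01; rewrite scaler0 addr0.
have /FN : `|(N / `|v|) *: v| = N.
  by rewrite normrZ ger0_norm ?divr_ge0// ?ltW// divfK// gt_eqF.
move: s01 => /andP[]; set s := N / _; nra.
Qed.

(** The tube lemma, for the open set where [f < g]. *)
Lemma near_compact_lt (K : set 'rV[R]_d) (f g : T * 'rV[R]_d -> R) z :
  compact K -> continuous f -> continuous g ->
  (forall v, K v -> f (z, v) < g (z, v)) ->
  \forall z' \near z, forall v, K v -> f (z', v) < g (z', v).
Proof.
move=> /compact_near_coveringP cK fc gc fg.
apply: (cK T (nbhs z) (fun z' v => f (z', v) < g (z', v))) => v Kv.
pose h w := g w - f w.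
have hc : continuous h by move=> w; apply: cvgB; [exact: gc|exact: fc].
have [[/= B C] [Bz Cv] BC] : nbhs (z, v) (h @^-1` [set r | 0 < r]).
  apply: (hc (z, v)); apply: open_nbhs_nbhs; split; first exact: open_gt.
  by rewrite /= subr_gt0; exact: fg.
exists (C, B) => //= -[v' z'] /= [Cv' Bz'].
by have := BC (z', v') (conj Bz' Cv'); rewrite /= subr_gt0.
Qed.

(** The upper semicontinuity of the supremum. Coercivity is an assumption at
    each parameter separately, but it only asks for a strict inequality on a
    sphere, so the tube lemma makes the radius N uniform near z; inside the
    ball of radius N the tube lemma applies once more. *)
Lemma near_sup_lt z c : (forall v, F (z, v) < c) ->
  \forall z' \near z, forall v, F (z', v) < c.
Proof.
move=> Fc; have [N N0 FN] := F_coercive z.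
have cst0 : continuous (fun w : T * 'rV[R]_d => F (w.1, 0 : 'rV[R]_d)).
  have fc : continuous (fun w : T * 'rV[R]_d => (w.1, 0 : 'rV[R]_d)).
    by apply: continuous_pair; [move=> w; exact: cvg_fst|exact: cst_continuous].
  exact: (continuous_compose fc F_cont).
have near1 := near_compact_lt (@norm_eq_compact _ _ N) F_cont cst0 FN.
have near2 : \forall z' \near z, forall v, `|v| <= N -> F (z', v) < c.
  apply: (@near_compact_lt _ F (cst c) z (@norm_le_compact _ _ N)) => //.
  exact: cst_continuous.
near=> z' => v; have [vN|/ltW Nv] := leP `|v| N.
  by move: v vN; near: z'.
apply: (@lt_trans _ _ (F (z', 0))).
  by apply: concave_lt_outside Nv => //; near: z'.
have : `|0 : 'rV[R]_d| <= N by rewrite normr0 ltW.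
by move: (0 : 'rV_d); near: z'.
Unshelve. all: by end_near. Qed.

Lemma concave_has_sup z : has_sup (range (fun v => F (z, v))).
Proof.
split; first by exists (F (z, 0)), 0.
have [N N0 FN] := F_coercive z.
have ball0 : [set v : 'rV[R]_d | `|v| <= N] 0 by rewrite /= normr0 ltW.
have [] := @compact_EVT_max _ _ (fun v => F (z, v)) _ (ex_intro _ 0 ball0)
  (@norm_le_compact _ _ N).
  apply: continuous_subspaceT.
  have fc : continuous (fun v : 'rV[R]_d => (z, v)).
    by apply: continuous_pair; [exact: cst_continuous|move=> x].
  exact: (continuous_compose fc F_cont).
move=> v _ Fv; exists (F (z, v)) => _ [w _ <-].
have [wN|/ltW Nw] := leP `|w| N; first by apply: Fv; rewrite inE.
apply: le_trans (ltW (concave_lt_outside N0 FN Nw)) _.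
by apply: Fv; rewrite inE.
Qed.

(** Lower semicontinuity is automatic for a supremum of continuous functions;
    upper semicontinuity is [near_sup_lt]. *)
Lemma concave_sup_continuous :
  continuous (fun z => sup (range (fun v => F (z, v)))).
Proof.
move=> z; apply/cvgrPdist_le => e e0.
have [_ [v _ <-] Fv] := sup_adherent e0 (concave_has_sup z).
have F_contz : continuous (fun z' => F (z', v)).
  have fc : continuous (fun z : T => (z, v)).
    by apply: continuous_pair => x; (exact: cvg_cst || exact: cvg_id).
  exact: (continuous_compose fc F_cont).
near=> z'.
rewrite distrC ler_distl; apply/andP; split.
  apply: (@le_trans _ _ (F (z', v))); last first.
    by apply: ub_le_sup; [exact: (concave_has_sup z').2|exists v].
  near: z'; move/cvgr_gt: (F_contz z) => /(_ _ Fv).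
  by apply: filterS => ?; exact: ltW.
apply: ge_sup; first exact: (concave_has_sup z').1.
move=> _ [w _ <-]; apply/ltW; move: w; near: z'; apply: near_sup_lt => w.
apply: (@le_lt_trans _ _ (sup (range (fun v => F (z, v))))).
  by apply: ub_le_sup; [exact: (concave_has_sup z).2|exists w].
by rewrite ltrDl.
Unshelve. all: by end_near. Qed.

End concave_sup.

(** * Euclidean estimates *)

Section euclid.
Context {R : realType} {n : nat}.
Implicit Types p v : 'rV[R]_n.

Lemma normr_coord_le v i : `|v 0 i| <= `|v|.
Proof.
rewrite [leRHS]/Num.norm /= mx_normrE; apply/bigmax_geP; right => /=.
by exists (ord0, i).
Qed.

Lemma normr_enorm v : `|v| <= enorm v.
Proof.
rewrite [leLHS]/Num.norm /= mx_normrE; apply/bigmax_leP; split => /=.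
  exact: sqrtr_ge0.
move=> [i j] _ /=; rewrite ord1 -sqrtr_sqr ler_wsqrtr//.
rewrite /dot (bigD1 j)//= expr2 lerDl sumr_ge0// => k _.
by rewrite -expr2 sqr_ge0.
Qed.

Lemma normr_dot_le p v : `|dot p v| <= (n%:R * `|p|) * `|v|.
Proof.
rewrite (le_trans (ler_norm_sum _ _ _))//.
have -> : (n%:R * `|p|) * `|v| = \sum_(i < n) `|p| * `|v|.
  by rewrite sumr_const card_ord -mulrA mulr_natl.
by apply: ler_sum => i _; rewrite normrM ler_pM// normr_coord_le.
Qed.

Lemma dotDr p v w : dot p (v + w) = dot p v + dot p w.
Proof. by rewrite -big_split/=; apply: eq_bigr => i _; rewrite mxE mulrDr. Qed.

Lemma dotZr p a v : dot p (a *: v) = a * dot p v.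
Proof.
by rewrite mulr_sumr; apply: eq_bigr => i _; rewrite mxE mulrCA.
Qed.

Lemma dot0r p : dot p 0 = 0.
Proof. by rewrite -(scale0r 0) dotZr mul0r. Qed.

Lemma continuous_dot (T : topologicalType) (p q : T -> 'rV[R]_n) :
  continuous p -> continuous q -> continuous (fun x => dot (p x) (q x)).
Proof.
move=> pc qc; apply: (@continuous_big _ _ _ _ xpredT add_continuous) => i _ x.
have coordc (f : T -> 'rV[R]_n) : continuous f -> continuous (fun x => f x 0 i).
  by move=> fc; exact: (continuous_compose fc (@coord_continuous _ _ _ 0 i)).
by apply: cvgM; exact: coordc.
Qed.

Lemma continuous_row (T : topologicalType) (f : 'I_n -> T -> R) :
  (forall i, continuous (f i)) -> continuous (fun x => \row_i f i x).
Proof.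
move=> fc x; apply/cvg_ballP => e e0.
have : \forall y \near x, forall i, ball (f i x) e (f i y).
  by apply: filter_forall => i; apply: (fc i x); exact: nbhsx_ballx.
by apply: filterS => y fxy; split => // i j; rewrite !mxE.
Qed.

Lemma continuous_enorm : continuous (@enorm R n).
Proof.
have id_cont : continuous (@id 'rV[R]_n) by move=> x.
have dot_cont := continuous_dot id_cont id_cont.
exact: (continuous_compose dot_cont (@sqrt_continuous R)).
Qed.

End euclid.

(** * Continuity of the Hamiltonian along a field of momenta *)

Lemma gradient_continuous {R : realType} {d : nat} (phi : torus R d.+1 -> R) :
  torus_C1 phi -> continuous (gradient phi).
Proof.
by move=> phi1; apply: continuous_row => i; exact: torus_partial_continuous.
Qed.

Section hamiltonian.
Context {R : realType} {d : nat} (L : torus R d.+1 * 'rV[R]_d -> R).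
Hypothesis L_C2 : lagrangian_C2 L.
Hypothesis L_convex : strictly_convex_velocity L.
Hypothesis L_superlinear : superlinear_velocity L.

Lemma lagrangian_continuous : continuous L.
Proof.
by case: L_C2 => Lc _; exact: torus_prod_continuous.
Qed.

Lemma lagrangian_convex z v w s : 0 < s < 1 ->
  L (z, s *: v + (1 - s) *: w) <= s * L (z, v) + (1 - s) * L (z, w).
Proof.
move=> s01; have [->|vw] := eqVneq v w; last exact/ltW/L_convex.
by rewrite -scalerDl -mulrDl addrC subrK scale1r mul1r.
Qed.

(** Superlinearity with slope [d |p| + 1] beats [p . v] by at least |v|, hence
    by more than L (z, 0) on a sphere of large radius. *)
Lemma lagrangian_coercive z p : exists2 N, 0 < N &
  forall v, `|v| = N -> dot p v - L (z, v) < dot p 0 - L (z, 0).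
Proof.
have [M LM] := L_superlinear z (d%:R * `|p| + 1).
exists (`|M| + `|L (z, 0)| + 1); first by rewrite ltr_wpDl// addr_ge0.
move=> v vN; have vM : M < `|v|.
  by rewrite vN (le_lt_trans (ler_norm M))// -addrA ltrDl ltr_wpDl.
have v0 : 0 < `|v| by rewrite vN ltr_wpDl// addr_ge0.
have ev := normr_enorm v; have e0 := lt_le_trans v0 ev.
have := LM v (lt_le_trans vM ev); rewrite ler_pdivlMr// => Lv.
have := normr_dot_le p v; rewrite dot0r ler_norml => /andP[_ pv].
have pn : 0 <= d%:R * `|p| by rewrite mulr_ge0.
have : (d%:R * `|p| + 1) * `|v| <= (d%:R * `|p| + 1) * enorm v.
  by rewrite ler_wpM2l// addr_ge0.
have := ler_norm (L (z, 0)); have := normr_ge0 M.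
rewrite mulrDl mul1r; move: vN; nra.
Qed.

Section along_field.
Variable p : torus R d.+1 -> 'rV[R]_d.
Hypothesis p_cont : continuous p.
Let F (w : torus R d.+1 * 'rV[R]_d) := dot (p w.1) w.2 - L w.

Let F_cont : continuous F.
Proof.
have fst_cont : continuous (@fst (torus R d.+1) 'rV[R]_d).
  by move=> w; exact: cvg_fst.
have snd_cont : continuous (@snd (torus R d.+1) 'rV[R]_d).
  by move=> w; exact: cvg_snd.
have dc := continuous_dot (continuous_compose fst_cont p_cont) snd_cont.
by move=> w; apply: cvgB; [exact: dc|exact: lagrangian_continuous].
Qed.

Let F_concave z v w s : 0 < s < 1 ->
  s * F (z, v) + (1 - s) * F (z, w) <= F (z, s *: v + (1 - s) *: w).
Proof.
move=> s01; rewrite /F/= dotDr !dotZr.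
have := lagrangian_convex z v w s01; lra.
Qed.

Let F_coercive z : exists2 N, 0 < N & forall v, `|v| = N -> F (z, v) < F (z, 0).
Proof. exact: (lagrangian_coercive z (p z)). Qed.

Lemma legendre_continuous : continuous (fun z => legendre L (z, p z)).
Proof. exact: (concave_sup_continuous F_cont F_concave F_coercive). Qed.

Lemma fenchel z v : dot (p z) v - L (z, v) <= legendre L (z, p z).
Proof.
have [_ Fub] := concave_has_sup F_cont F_concave F_coercive z.
by apply: ub_le_sup => //; exists v.
Qed.

End along_field.

End hamiltonian.

(** * Integration lemmas and the Gibbs variational inequality *)

Section integrals.
Local Open Scope ereal_scope.

Lemma measurable_open_generated (R : realType) (T : pointedType)
    (G : set (set T)) (f : T -> R) :
  (forall U, open U -> G (f @^-1` U)) ->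
  measurable_fun [set: g_sigma_algebraType G] f.
Proof.
move=> Gf; apply: (measurability _ (RGenOpens.measurableE R)).
move=> _ [_ [a [b ->] <-]]; rewrite setTI; apply: sub_sigma_algebra.
exact/Gf/interval_open.
Qed.

Lemma borel_torus_measurable (R : realType) n (f : torus R n -> R) :
  continuous f -> measurable_fun [set: borel (torus R n)] f.
Proof. by move=> /continuousP fc; exact: measurable_open_generated. Qed.

Lemma borel_phase_measurable (R : realType) n m
    (f : torus R n * 'rV[R]_m -> R) :
  continuous f -> measurable_fun [set: borel (torus R n * 'rV[R]_m)%type] f.
Proof. by move=> /continuousP fc; exact: measurable_open_generated. Qed.

Context d (T : measurableType d) (R : realType).

(** Only the minorant has to be integrable: the integral of g may be +oo, as
    happens for the Lagrangian and for the entropy. *)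
Lemma integrable_le_integral (mu : {measure set T -> \bar R})
    (f g : T -> \bar R) :
  mu.-integrable setT f -> measurable_fun setT g ->
  {ae mu, forall x, f x <= g x} -> \int[mu]_x f x <= \int[mu]_x g x.
Proof.
move=> intf mg fg; have mf := measurable_int _ intf.
rewrite integralE [leRHS]integralE leeB//.
- apply: ae_ge0_le_integral => //; first exact: measurable_funepos.
    exact: measurable_funepos.
  apply: filterS fg => x fgx _.
  by apply: (@funepos_le _ _ [set x] f g); rewrite ?inE// => y /[!inE] ->.
- apply: ae_ge0_le_integral => //; first exact: measurable_funeneg.
    exact: measurable_funeneg.
  apply: filterS fg => x fgx _.
  by apply: (@funeneg_le _ _ [set x] f g); rewrite ?inE// => y /[!inE] ->.
Qed.

Lemma bounded_integrable (P : probability T R) (f : T -> R) M :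
  measurable_fun setT f -> (forall x, `|f x| <= M)%R ->
  P.-integrable setT (EFin \o f).
Proof.
move=> mf fM; apply: measurable_bounded_integrable => //.
  by rewrite ltey_eq fin_num_measure.
exists M; split; first by rewrite num_real.
by move=> N MN x _ /=; rewrite (le_trans (fM x))// ltW.
Qed.

Lemma expR_integral_finite_pos (P : probability T R) (G : T -> R) M :
  measurable_fun setT G -> (forall x, `|G x| <= M)%R ->
  exists2 I : R, (0 < I)%R & \int[P]_x (expR (G x))%:E = I%:E.
Proof.
move=> mG GM.
have intc c : P.-integrable setT (cst c%:E).
  exact: finite_measure_integrable_cst.
have mexp : measurable_fun setT (fun x => expR (G x)).
  exact: measurableT_comp.
have int_exp : P.-integrable setT (EFin \o (fun x => expR (G x))).
  apply: (@bounded_integrable _ _ (expR M)) => // x.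
  by rewrite ger0_norm ?expR_ge0// ler_expR (le_trans (ler_norm _))//.
have fin := integrable_fin_num measurableT int_exp.
exists (fine (\int[P]_x (expR (G x))%:E)); last by rewrite fineK.
rewrite -lte_fin fineK//; apply: (@lt_le_trans _ _ (expR (- M))%:E).
  by rewrite lte_fin expR_gt0.
rewrite -[leLHS]mule1 -(@probability_setT _ _ _ P) -integral_cst//.
apply: le_integral => // x _; rewrite lee_fin ler_expR.
by move: (GM x); rewrite ler_norml => /andP[].
Qed.

(** Young's inequality for the conjugate pair [r ln r - r], [exp a]; for
    r > 0 it is [1 + u <= exp u] at [u = a - ln r]. *)
Lemma xlnx_ge (r a : R) : (0 <= r)%R -> (r * (a + 1) - expR a <= r * ln r)%R.
Proof.
rewrite le_eqVlt => /predU1P[<-|r0].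
  by rewrite !mul0r sub0r oppr_le0 expR_ge0.
have := expR_ge1Dx (a - ln r); rewrite expRB lnK ?posrE//.
rewrite ler_pdivlMr// lerBlDr => h.
rewrite -lerBlDl; apply: le_trans h; lra.
Qed.

Local Open Scope charge_scope.

(** Young's inequality with r the density of m and [a = G - ln I], integrated:
    the normalization by ln I makes [exp a] a probability density, so the two
    constants 1 that appear cancel. *)
Lemma gibbs_variational (lam m : probability T R) (G : T -> R) M (I : R) :
  m `<< lam -> measurable_fun setT G -> (forall x, `|G x| <= M)%R ->
  (0 < I)%R -> \int[lam]_x (expR (G x))%:E = I%:E ->
  \int[m]_x (G x)%:E <= (ln I)%:E +
    \int[lam]_x
      (let r := fine (('d (charge_of_finite_measure m) '/d lam) x) in
       (r * ln r)%:E).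
Proof.
move=> mlam mG GM I0 IE.
set r := 'd (charge_of_finite_measure m) '/d lam.
pose a x := (G x - ln I)%R.
have ma : measurable_fun setT a by exact: measurable_funB.
have a_bound x : (`|a x + 1| <= M + `|ln I| + 1)%R.
  rewrite (le_trans (ler_normD _ _))// normr1 lerD2r.
  by rewrite (le_trans (ler_normB _ _))// lerD2r.
have ma1 : measurable_fun setT (fun x => a x + 1)%R by exact: measurable_funD.
have bnd_a1 : [bounded (a x + 1)%R | x in setT].
  exists (M + `|ln I| + 1)%R; split; first by rewrite num_real.
  by move=> N MN x _ /=; rewrite (le_trans (a_bound x))// ltW.
have int_a1 : m.-integrable setT (fun x => (a x + 1)%:E).
  exact: (bounded_integrable _ ma1 a_bound).
have r_fin x : r x \is a fin_num by exact: Radon_Nikodym_fin_num.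
have r_int : lam.-integrable setT r by exact: Radon_Nikodym_integrable.
(* The derivative of a charge carries no sign; it agrees almost everywhere with
   the nonnegative density of the measure. *)
have r_ge0 : {ae lam, forall x, 0 <= r x}.
  have := ae_eq_Radon_Nikodym_SigmaFinite mlam measurableT.
  apply: filterS => x /(_ Logic.I) rE; rewrite /r -rE.
  exact: Radon_Nikodym_SigmaFinite.f_ge0.
have int_ar : lam.-integrable setT ((fun x => (a x + 1)%:E) \* r).
  exact: integrableMr.
have int_G : m.-integrable setT (fun x => (G x)%:E).
  exact: bounded_integrable GM.
have expaE x : expR (a x) = (I^-1 * expR (G x))%R.
  by rewrite /a expRB lnK ?posrE// mulrC.
have mexp : measurable_fun setT (fun x => expR (G x)).
  exact: measurableT_comp.
have int_expG : lam.-integrable setT (fun x => (expR (G x))%:E).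
  apply: (@bounded_integrable _ _ (expR M)) => // x.
  by rewrite ger0_norm ?expR_ge0// ler_expR (le_trans (ler_norm _)).
have int_exp : lam.-integrable setT (fun x => (expR (a x))%:E).
  under eq_fun do rewrite expaE EFinM.
  exact: integrableZl.
have lowerE : \int[lam]_x ((a x + 1)%:E * r x - (expR (a x))%:E) =
              \int[m]_x (G x)%:E - (ln I)%:E.
  rewrite integralB// Radon_Nikodym_change_of_variables//.
  have -> : \int[lam]_x (expR (a x))%:E = 1.
    under eq_integral do rewrite expaE EFinM.
    by rewrite integralZl// IE -EFinM mulVf ?gt_eqF.
  have -> : \int[m]_x (a x + 1)%:E = \int[m]_x (G x)%:E + (1 - ln I)%:E.
    under eq_integral => x _ do rewrite /a -addrA EFinD [(- _ + _)%R]addrC.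
    rewrite integralD//; last exact: finite_measure_integrable_cst.
    rewrite integral_cst// [X in _ * X](_ : _ = 1) ?mule1//.
    exact: probability_setT.
  have := integrable_fin_num measurableT int_G.
  case: (\int[m]_x (G x)%:E) => //= g _; rewrite -!EFinD; congr EFin; lra.
rewrite addeC -leeBlDr// -lowerE; apply: integrable_le_integral.
- exact: integrableB.
- have mr : measurable_fun setT (fun x => fine (r x)).
    apply: measurableT_comp => //; exact: measurable_int r_int.
  apply/measurable_EFinP; apply: measurable_funM => //.
  exact: measurableT_comp (@measurable_ln R) mr.
- apply: filterS r_ge0 => x r0 /=.
  have /fineK := r_fin x; move: r0 => /fine_ge0 r0 {1}<-.
  by rewrite -EFinM -EFinB lee_fin mulrC xlnx_ge.
Qed.

End integrals.

(** * Lower bound on the relaxed entropy *)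

Section relaxed_entropy_bound.
Local Open Scope ereal_scope.
Context {R : realType}.

Lemma le_limn_einf (u v : (\bar R)^nat) :
  (forall n, u n <= v n) -> limn_einf u <= limn_einf v.
Proof.
move=> uv; rewrite !limn_einf_lim; apply: lee_lim.
- exact: is_cvg_einfs.
- exact: is_cvg_einfs.
apply: nearW => n; apply: le_ereal_inf_tmp => _ [k nk <-].
by apply: le_trans (uv k); apply: ereal_inf_lbound; exists k.
Qed.

(** The lower bound [int G dm - ln I] on the entropy is weakly continuous in m,
    so it survives the relaxation. *)
Lemma relaxed_entropy_ge d (m : probability (borel (torus R d.+1)) R)
    (G : torus R d.+1 -> R) (I : R) :
  continuous G -> (0 < I)%R ->
  \int[torus_lebesgue R d.+1]_z (expR (G z))%:E = I%:E ->
  \int[m]_z (G z)%:E - (ln I)%:E <= relaxed_entropy m.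
Proof.
move=> Gc I0 IE; have [M _ GM] := torus_bounded Gc.
have mG := borel_torus_measurable Gc.
apply: le_ereal_inf_tmp => _ [m_ [m_ac m_m ->]].
have m_cvg : \int[m_ n]_z (G z)%:E - (ln I)%:E @[n --> \oo] -->
    \int[m]_z (G z)%:E - (ln I)%:E.
  apply: cvgeB; first by rewrite fin_num_adde_defl.
    exact: m_m.
  exact: cvg_cst.
have [<- _] := cvg_limn_einf_sup m_cvg.
apply: le_limn_einf => n; rewrite leeBlDl//.
exact: (gibbs_variational (m_ac n) mG GM I0 IE).
Qed.

End relaxed_entropy_bound.

(** * The duality inequality for one test function and one measure *)

Section duality.
Local Open Scope ereal_scope.
Context {R : realType} {d : nat} (L : torus R d.+1 * 'rV[R]_d -> R).
Hypothesis L_C2 : lagrangian_C2 L.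
Hypothesis L_convex : strictly_convex_velocity L.
Hypothesis L_superlinear : superlinear_velocity L.
Variable phi : torus R d.+1 -> R.
Hypothesis phi_C1 : torus_C1 phi.

Let phase := (torus R d.+1 * 'rV[R]_d)%type.
Let g z := (time_derivative phi z + legendre L (z, gradient phi z))%R.
Let a (w : phase) := (time_derivative phi w.1 + dot (gradient phi w.1) w.2)%R.

Let dt_cont : continuous (time_derivative phi).
Proof. exact: torus_partial_continuous. Qed.

Let grad_cont : continuous (gradient phi).
Proof. exact: gradient_continuous. Qed.

Lemma hamilton_jacobi_continuous : continuous g.
Proof.
have hc := legendre_continuous L_C2 L_convex L_superlinear grad_cont.
by move=> z; exact: (cvgD (@dt_cont z) (hc z)).
Qed.

Let fst_cont : continuous (@fst (torus R d.+1) 'rV[R]_d).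
Proof. by move=> w; exact: cvg_fst. Qed.

Let snd_cont : continuous (@snd (torus R d.+1) 'rV[R]_d).
Proof. by move=> w; exact: cvg_snd. Qed.

Let a_cont : continuous a.
Proof.
have c1 := continuous_compose fst_cont dt_cont.
have c2 := continuous_dot (continuous_compose fst_cont grad_cont) snd_cont.
by move=> w; exact: (cvgD (c1 w) (c2 w)).
Qed.

Variable mu : probability (borel phase) R.
Hypothesis mu_closed : closed_measure mu.

Lemma velocity_integrable : mu.-integrable setT (fun w => (enorm w.2)%:E).
Proof.
have ec := continuous_compose snd_cont (@continuous_enorm R d).
apply/integrableP; split.
  by apply/measurable_EFinP; exact: (borel_phase_measurable ec).
case: mu_closed => + _; apply: le_lt_trans.
rewrite le_eqVlt; apply/orP; left; apply/eqP; apply: eq_integral => w _ /=.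
by rewrite ger0_norm// sqrtr_ge0.
Qed.

(** Linear growth in v with bounded coefficients, against a finite first
    moment. *)
Lemma material_derivative_integrable : mu.-integrable setT (fun w => (a w)%:E).
Proof.
have [M1 _ dtM] := torus_bounded dt_cont.
have norm_cont : continuous (fun z => `|gradient phi z|%R).
  exact: (continuous_compose grad_cont (@norm_continuous _ _)).
have [M2 M20 gradM] := torus_bounded norm_cont.
have int_bound : mu.-integrable setT
    (fun w => M1%:E + (d%:R * M2)%:E * (enorm w.2)%:E).
  apply: integrableD => //; first exact: finite_measure_integrable_cst.
  by apply: integrableZl => //; exact: velocity_integrable.
apply: le_integrable int_bound => //.
  by apply/measurable_EFinP; exact: (borel_phase_measurable a_cont).
move=> w _; rewrite -EFinM -EFinD/= lee_fin.
rewrite (le_trans (ler_normD _ _))// (le_trans _ (ler_norm _))// lerD//.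
rewrite (le_trans (normr_dot_le _ _))// ler_pM ?mulr_ge0 ?normr_enorm//.
by rewrite ler_wpM2l// (le_trans _ (gradM w.1))// normr_id.
Qed.

(** The Fenchel inequality [a w - g w.1 <= L w], integrated; closedness of mu
    kills the integral of a. *)
Lemma lagrangian_integral_ge :
  - (\int[base_marginal mu]_z (g z)%:E) <= \int[mu]_w (L w)%:E.
Proof.
have gc := hamilton_jacobi_continuous; have [M _ gM] := torus_bounded gc.
have mg := borel_torus_measurable gc.
have mg_fst := borel_phase_measurable (continuous_compose fst_cont gc).
have int_g : mu.-integrable setT (fun w => (g w.1)%:E).
  by apply: (bounded_integrable _ mg_fst) => w; exact: gM.
have -> : \int[base_marginal mu]_z (g z)%:E = \int[mu]_w (g w.1)%:E.
  apply: integral_distribution => //; exact/measurable_EFinP.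
have int_a := material_derivative_integrable.
have -> : - (\int[mu]_w (g w.1)%:E) = \int[mu]_w ((a w)%:E - (g w.1)%:E).
  by rewrite integralB// (mu_closed.2 phi phi_C1) sub0e.
apply: integrable_le_integral; first exact: integrableB.
  apply/measurable_EFinP.
  exact: (borel_phase_measurable (lagrangian_continuous L_C2)).
apply: aeW => -[z v]; rewrite -EFinB lee_fin /a /g/=.
have := fenchel L_C2 L_convex L_superlinear grad_cont z v; lra.
Qed.

Lemma action_ge k : (0 < k)%N ->
  - (k%:R^-1%:E * lne (exp_integral k (legendre L) phi)) <= action k L mu.
Proof.
move=> k0; have kR : (0 < k%:R :> R)%R by rewrite ltr0n.
have gc := hamilton_jacobi_continuous; have [M _ gM] := torus_bounded gc.
have Gc : continuous (fun z => k%:R * g z)%R.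
  have kc : continuous (cst k%:R : torus R d.+1 -> R).
    exact: cst_continuous.
  by move=> z; exact: (cvgM (kc z) (gc z)).
have mG := borel_torus_measurable Gc.
have [M' _ GM] := torus_bounded Gc.
have [I I0 IE] := expR_integral_finite_pos (torus_lebesgue R d.+1) mG GM.
rewrite /exp_integral IE lne_EFin//.
have S_ge := relaxed_entropy_ge (base_marginal mu) Gc I0 IE.
have L_ge := lagrangian_integral_ge.
have mg := borel_torus_measurable gc.
have int_g := bounded_integrable (base_marginal mu) mg gM.
have GE : \int[base_marginal mu]_z (k%:R * g z)%:E =
          k%:R%:E * \int[base_marginal mu]_z (g z)%:E.
  under eq_integral do rewrite EFinM.
  by rewrite integralZl.
move: S_ge L_ge (integrable_fin_num measurableT int_g); rewrite GE.
case: (\int[base_marginal mu]_z (g z)%:E) => //= gamma S_ge L_ge _.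
have kV : 0 <= k%:R^-1%:E :> \bar R by rewrite lee_fin invr_ge0 ltW.
(* The integral gamma of g cancels: -gamma + (1/k)(k gamma - ln I). *)
apply: le_trans (leeD L_ge (lee_wpmul2l kV S_ge)).
rewrite lee_fin.
by rewrite mulrBr mulrA mulVf ?gt_eqF// mul1r addrA addNr sub0r.
Qed.

End duality.

(** * The inequality between the two infima *)

Theorem proposition1 (R : realType) (d k : nat)
    (L : torus R d.+1 * 'rV[R]_d -> R) :
  (1 <= k)%N ->
  lagrangian_C2 L -> strictly_convex_velocity L -> superlinear_velocity L ->
  (- ((k%:R^-1)%:E * ereal_inf [set lne (exp_integral k (legendre L) phi) |
        phi in [set phi : torus R d.+1 -> R | torus_C1 phi]])
   <= ereal_inf [set action k L mu | mu in @closed_measure R d])%E.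
Proof.
move=> k0 L_C2 L_convex L_superlinear.
have kR : (0 < k%:R :> R)%R by rewrite ltr0n.
apply: le_ereal_inf_tmp => _ [mu mu_closed <-].
rewrite leeNl lee_pdivlMl//; apply: le_ereal_inf_tmp => _ [phi phi_C1 <-].
by rewrite -lee_pdivlMl// -leeNl; exact: action_ge.
Qed.
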